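(* Let $\mathcal G$ be a locally finite $\Gamma$-periodic graph with fundamental graph $\mathcal G_*=(\mathcal V_*,\mathcal A_* )$, $\nu=\#\mathcal V_*$, let $V$ be a real $\Gamma$-periodic potential, and let $H(k)=A(k)-\varkappa+V$, $k\in\mathbb T^d$, be the fiber Schrödinger operator on $\ell^2(\mathcal V_* )$ with eigenvalues $\lambda_1(k)\le\dots\le\lambda_\nu(k)$ (counted with multiplicity). Then for each $n\in\mathbb N$ and $k\in\mathbb T^d$ $$\operatorname{Tr}H^n(k)=\sum_{j=1}^{\nu}\lambda_j^n(k)=\mathcal T_n(k),\qquad \mathcal T_n(k)=\sum_{\mathbf c\in\widetilde{\mathcal C}_n}\omega(\mathbf c)\cos\langle\tau(\mathbf c),k\rangle .$$ In particular, with $v_x=V_x-\varkappa_x$, $$\operatorname{Tr}H(k)=\mathcal T_1(k)=\sum_{x\in\mathcal V_*}v_x+\sum_{\mathbf c\in\mathcal C_1}\cos\langle\tau(\mathbf c),k\rangle,$$ $$\operatorname{Tr}H^2(k)=\mathcal T_2(k)=\sum_{x\in\mathcal V_*}v_x^2+2\sum_{\mathbf c\in\mathcal C_1}v(\mathbf c)\cos\langle\tau(\mathbf c),k\rangle+\sum_{\mathbf c\in\mathcal C_2}\cos\langle\tau(\mathbf c),k\rangle .$$ If there are no loops in $\mathcal G_*$, then $\operatorname{Tr}H(k)=\mathcal T_1(k)=\sum_{x\in\mathcal V_*}v_x$; and if, in addition, there are no multiple edges in $\mathcal G_*$, then $\operatorname{Tr}H^2(k)=\mathcal T_2(k)=\#\mathcal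 A_*+\|v\|_*^2$, where $\|v\|_*^2=\sum_{x\in\mathcal V_*}v_x^2$ and $\#\mathcal A_*=\sum_{x\in\mathcal V_*}\varkappa_x>0$.
   Context: Periodic graph. $\mathcal G=(\mathcal V,\mathcal E)$ is a connected infinite graph, possibly having loops and multiple edges, embedded into $\mathbb R^d$; $\mathcal V$ is its vertex set, $\mathcal E$ its set of unoriented edges. Each edge in $\mathcal E$ has two orientations, and $\mathcal A$ is the set of all oriented edges. An oriented edge starting at $x$ and ending at $y$ is denoted $(x,y)$ (several edges may have the same end points), and $\underline{\mathbf e}$ is the inverse of $\mathbf e$. The degree $\varkappa_x$ is the number of edges of $\mathcal A$ starting at $x$. $\Gamma\subset\mathbb R^d$ is a lattice of rank $d$ with basis $a_1,\dots,a_d$. The graph is locally finite and $\Gamma$-periodic: $\mathcal G+a=\mathcal G$ for all $a\in\Gamma$, and the quotient (fundamental) graph $\mathcal G_*=\mathcal G/\Gamma=(\mathcal V_*,\mathcal A_* )$ with $\mathcal V_*=\mathcal V/\Gamma$, $\mathcal A_*=\mathcal A/\Gamma$ is finite. Edge index. Let $\Omega=\{\sum_s t_sa_s:\ t_s\in[0,1)\}$. Each $x\in\mathcal V$ is uniquely $x=x_0+[x]$ with $x_0\in\Omega$, $[x]\in\Gamma$; $[x]_{\mathbb A}\in\mathbb Z^d$ is the coordinate vector of $[x]$ in the basis $a_1,\dots,a_d$. For $\mathbf e=(x,y)\in\mathcal A$ put $\tau(\mathbf e)=[y]_{\mathbb A}-[x]_{\mathbb A}\in\mathbb Z^d$. This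 is $\Gamma$-invariant, so it induces the index $\tau(\mathbf e)$ for $\mathbf e\in\mathcal A_*$. One has $\tau(\underline{\mathbf e})=-\tau(\mathbf e)$. Operators. $V$ is a real function on $\mathcal V$ with $V_{x+a}=V_x$ for $a\in\Gamma$; $V$ and $\varkappa$ are regarded also as functions (diagonal operators) on $\mathcal V_*$. With $\mathbb T^d=\mathbb R^d/(2\pi\mathbb Z)^d$: $(A(k)f)_x=\sum_{\mathbf e=(x,y)\in\mathcal A_*}e^{i\langle\tau(\mathbf e),k\rangle}f_y$ and $H(k)=A(k)-\varkappa+V$ on $\ell^2(\mathcal V_* )=\mathbb C^\nu$. Cycles. A cycle of length $n\geq1$ in a graph is a sequence $\mathbf c=(\mathbf e_1,\dots,\mathbf e_n)$ of oriented edges $\mathbf e_j=(x_j,x_{j+1})$, $x_{n+1}=x_1$ (a closed walk; the starting point and direction matter, and backtracking is allowed); $|\mathbf c|=n$; its index is $\tau(\mathbf c)=\sum_j\tau(\mathbf e_j)$. $\mathcal C_n$ is the set of cycles of length $n$ in $\mathcal G_*$. Modified graph. $\widetilde{\mathcal G}_*=(\mathcal V_*,\widetilde{\mathcal A}_* )$ is obtained by adding at each $x\in\mathcal V_*$ one loop $\mathbf e_x$ (a single element of $\widetilde{\mathcal A}_*$, its own inverse): $\widetilde{\mathcal A}_*=\mathcal A_*\cup\{\mathbf e_x\}_{x\in\mathcal V_*}$, $\tau(\mathbf e_x)=0$. $\widetilde{\mathcal C}_n$ is the set of cycles of length $n$ in $\widetilde{\mathcal G}_*$. Edge weights: $\omega(\mathbf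 e)=1$ for $\mathbf e\in\mathcal A_*$, $\omega(\mathbf e_x)=v_x:=V_x-\varkappa_x$. For a cycle $\mathbf c=(\mathbf e_1,\dots,\mathbf e_n)$, $\mathbf e_j=(x_j,x_{j+1})$: $\omega(\mathbf c)=\omega(\mathbf e_1)\cdots\omega(\mathbf e_n)$ and $v(\mathbf c)=v_{x_1}+\dots+v_{x_n}$. *)

(* Defs.v *)
From HB Require Import structures.
From mathcomp Require Import all_boot all_order all_algebra.
From mathcomp Require Import generic_quotient finmap complex.
From mathcomp Require Import all_classical all_reals.
From mathcomp Require Import trigo.

Set Implicit Arguments.
Unset Strict Implicit.
Unset Printing Implicit Defensive.

Import Order.TTheory GRing.Theory Num.Theory.

Local Open Scope ring_scope.
Local Open Scope classical_set_scope.
Local Open Scope quotient_scope.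
Local Open Scope complex_scope.

Section Lattice.
Variables (R : realType) (d : nat) (B : 'M[R]_d).

(* The lattice vector \sum_s m_s a_s, where a_s is the s-th row of B. *)
Definition lattice_vec (m : 'rV[int]_d) : 'rV[R]_d := map_mx intr m *m B.

Definition fundamental_cell : set 'rV[R]_d :=
  [set t *m B | t in [set t : 'rV[R]_d | forall s, 0 <= t 0 s < 1]].

(* The coordinates [x]_A of the lattice part of x. *)
Definition lattice_part (x : 'rV[R]_d) : 'rV[int]_d :=
  xget 0 [set m | fundamental_cell (x - lattice_vec m)].

Lemma lattice_vec0 : lattice_vec 0 = 0.
Proof. by rewrite /lattice_vec map_mx0 mul0mx. Qed.

Lemma lattice_vecD m n : lattice_vec (m + n) = lattice_vec m + lattice_vec n.
Proof. by rewrite /lattice_vec map_mxD mulmxDl. Qed.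

Hypothesis B_unit : B \in unitmx.

Lemma fundamental_cellE x m :
  fundamental_cell (x - lattice_vec m) <->
  m = \row_s Num.floor ((x *m invmx B) 0 s).
Proof.
split=> [[t t01 tE]|->].
  have xE : x *m invmx B = t + map_mx intr m.
    by rewrite -(mulmxK B_unit (t + _)) mulmxDl tE subrK.
  apply/rowP => s; rewrite mxE; apply/esym/floor_def.
  rewrite xE !mxE intrD; have /andP[t0 t1] := t01 s.
  by rewrite lerDr t0 /= addrC ltrD2l.
exists (x *m invmx B - map_mx intr (\row_s Num.floor ((x *m invmx B) 0 s))).
  move=> s /=; rewrite mxE [X in _ + X]mxE !mxE.
  have /andP[h1 h2] := floor_itv (\sum_j x 0 j * invmx B j s).
  by rewrite subr_ge0 h1 /= ltrBlDr addrC -[X in _ + X]/(1%:~R) -intrD.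
by rewrite mulmxBl mulmxKV.
Qed.

Lemma lattice_partP x m :
  fundamental_cell (x - lattice_vec m) <-> m = lattice_part x.
Proof.
rewrite /lattice_part; case: xgetP => [n _ /= /fundamental_cellE ->|noP].
  exact: fundamental_cellE.
case: (noP (\row_s Num.floor ((x *m invmx B) 0 s))).
exact/fundamental_cellE.
Qed.

Lemma lattice_partD x m : lattice_part (x + lattice_vec m) = lattice_part x + m.
Proof.
apply/esym/lattice_partP; rewrite lattice_vecD opprD addrACA subrr addr0.
exact/lattice_partP.
Qed.

End Lattice.

Section Walk.
Variables (T E : Type) (src tgt : E -> T).

Fixpoint walk (x : T) (p : seq E) (y : T) : Prop :=
  if p is e :: p' then src e = x /\ walk (tgt e) p' y else x = y.

End Walk.

(* A graph with vertices in R^d, possibly with loops and multiple edges,       *)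
(* invariant under the lattice spanned by the rows of [basis]. The lattice is  *)
(* identified with Z^d through that basis. [edge] is the type of oriented      *)
(* edges; an unoriented edge is a pair {e, einv e}.                            *)
Record latticeGraph (R : realType) (d : nat) := LatticeGraph {
  basis : 'M[R]_d;
  basis_unit : basis \in unitmx;
  vert : choiceType;
  edge : choiceType;
  pos : vert -> 'rV[R]_d;
  pos_inj : injective pos;
  src : edge -> vert;
  tgt : edge -> vert;
  einv : edge -> edge;
  einvK : involutive einv;
  einv_neq : forall e, einv e <> e;
  src_einv : forall e, src (einv e) = tgt e;
  vtrans : 'rV[int]_d -> vert -> vert;
  pos_vtrans : forall m x, pos (vtrans m x) = pos x + lattice_vec basis m;
  etrans : 'rV[int]_d -> edge -> edge;
  etrans0 : forall e, etrans 0 e = e;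
  etransD : forall m n e, etrans (m + n) e = etrans m (etrans n e);
  src_etrans : forall m e, src (etrans m e) = vtrans m (src e);
  tgt_etrans : forall m e, tgt (etrans m e) = vtrans m (tgt e);
  einv_etrans : forall m e, einv (etrans m e) = etrans m (einv e)
}.

Section Quotient.
Variables (R : realType) (d : nat) (G : latticeGraph R d).

Lemma vtrans0 x : vtrans 0 x = x :> vert G.
Proof. by apply: pos_inj; rewrite pos_vtrans lattice_vec0 addr0. Qed.

Lemma vtransD m n x : vtrans (m + n) x = vtrans m (vtrans n x) :> vert G.
Proof.
apply: pos_inj; rewrite !pos_vtrans lattice_vecD -addrA.
by congr (_ + _); rewrite addrC.
Qed.

Definition vrel : rel (vert G) := fun x y => `[< exists m, y = vtrans m x >].
Definition erel : rel (edge G) := fun e f => `[< exists m, f = etrans m e >].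

Lemma vrel_refl : reflexive vrel.
Proof. by move=> x; apply/asboolP; exists 0; rewrite vtrans0. Qed.

Lemma vrel_sym : symmetric vrel.
Proof.
suff h x y : vrel x y -> vrel y x by move=> x y; apply/idP/idP; exact: h.
move=> /asboolP[m ->]; apply/asboolP; exists (- m).
by rewrite -vtransD addNr vtrans0.
Qed.

Lemma vrel_trans : transitive vrel.
Proof.
move=> y x z /asboolP[m ->] /asboolP[n ->].
by apply/asboolP; exists (n + m); rewrite vtransD.
Qed.

Lemma erel_refl : reflexive erel.
Proof. by move=> x; apply/asboolP; exists 0; rewrite etrans0. Qed.

Lemma erel_sym : symmetric erel.
Proof.
suff h x y : erel x y -> erel y x by move=> x y; apply/idP/idP; exact: h.
move=> /asboolP[m ->]; apply/asboolP; exists (- m).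
by rewrite -etransD addNr etrans0.
Qed.

Lemma erel_trans : transitive erel.
Proof.
move=> y x z /asboolP[m ->] /asboolP[n ->].
by apply/asboolP; exists (n + m); rewrite etransD.
Qed.

Canonical vrel_equiv := EquivRel vrel vrel_refl vrel_sym vrel_trans.
Canonical erel_equiv := EquivRel erel erel_refl erel_sym erel_trans.

Definition vquot := {eq_quot vrel_equiv}.
HB.instance Definition _ := Choice.on vquot.
HB.instance Definition _ := EqQuotient.on vquot.

Definition equot := {eq_quot erel_equiv}.
HB.instance Definition _ := Choice.on equot.
HB.instance Definition _ := EqQuotient.on equot.

Lemma vquot_eqP (x y : vert G) :
  reflect (exists m, y = vtrans m x) (\pi_vquot x == \pi_vquot y).
Proof. by rewrite eqmodE /= /vrel; exact: asboolP. Qed.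

Lemma equot_eqP (e f : edge G) :
  reflect (exists m, f = etrans m e) (\pi_equot e == \pi_equot f).
Proof. by rewrite eqmodE /= /erel; exact: asboolP. Qed.

End Quotient.

Lemma finite_enumP (T : choiceType) (T_fin : finite_set [set: T]) :
  Finite.axiom (enum_fset (fset_set [set: T])).
Proof.
move=> x; rewrite count_uniq_mem ?fset_uniq//.
by have /= -> := in_fset_set T_fin x; rewrite in_setT.
Qed.

Definition finite_type (T : choiceType) of finite_set [set: T] : Type := T.

Section FiniteType.
Variables (T : choiceType) (T_fin : finite_set [set: T]).
HB.instance Definition _ := Choice.on (finite_type T_fin).

Let index_enum (x : finite_type T_fin) : nat :=
  seq.index (x : T) (fset_set [set: T]).
Let nth_enum (i : nat) : option (finite_type T_fin) :=
  onth (fset_set [set: T]) i.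

Lemma index_enumK : pcancel index_enum nth_enum.
Proof.
move=> x; rewrite /nth_enum /index_enum.
have xT : (x : T) \in fset_set [set: T].
  by have -> := in_fset_set T_fin x; rewrite in_setT.
by rewrite onthE (nth_map (x : T)) ?index_mem// nth_index.
Qed.

HB.instance Definition _ := PCanIsCountable index_enumK.
HB.instance Definition _ :=
  isFinite.Build (finite_type T_fin) (finite_enumP T_fin).
End FiniteType.

Record periodicGraph (R : realType) (d : nat) := PeriodicGraph {
  pgraph :> latticeGraph R d;
  pg_infinite : infinite_set [set: vert pgraph];
  pg_connected : forall x y : vert pgraph,
    exists p, walk (@src _ _ pgraph) (@tgt _ _ pgraph) x p y;
  pg_locally_finite : forall x : vert pgraph, finite_set [set e | src e = x];
  pg_vquot_finite : finite_set [set: vquot pgraph];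
  pg_equot_finite : finite_set [set: equot pgraph]
}.

Definition degree (R : realType) (d : nat) (G : latticeGraph R d) (x : vert G)
  : nat := #|` fset_set [set e : edge G | src e = x] |.

Definition edge_index (R : realType) (d : nat) (G : latticeGraph R d) (e : edge G)
  : 'rV[int]_d :=
  lattice_part (basis G) (pos (tgt e)) - lattice_part (basis G) (pos (src e)).

(* Functions on the fundamental graph are read off on representatives; the    *)
(* lemmas with suffix _pi show that the choice of representative is immaterial. *)
Section FundamentalGraph.
Variables (R : realType) (d : nat) (G : periodicGraph R d).

Definition fvert : finType := finite_type (pg_vquot_finite G).
Definition fedge : finType := finite_type (pg_equot_finite G).

Definition vclass (x : vert G) : fvert := \pi_(vquot G) x.
Definition eclass (e : edge G) : fedge := \pi_(equot G) e.
Definition vrepr (x : fvert) : vert G := repr (x : vquot G).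
Definition erepr (e : fedge) : edge G := repr (e : equot G).

Definition fsrc (e : fedge) : fvert := vclass (src (erepr e)).
Definition ftgt (e : fedge) : fvert := vclass (tgt (erepr e)).
Definition finv (e : fedge) : fedge := eclass (einv (erepr e)).
Definition findex (e : fedge) : 'rV[int]_d := edge_index (erepr e).
Definition fdegree (x : fvert) : nat := degree (vrepr x).

Lemma vreprK x : vclass (vrepr x) = x.
Proof. exact: reprK. Qed.

Lemma ereprK e : eclass (erepr e) = e.
Proof. exact: reprK. Qed.

Lemma vclassP (x y : vert G) :
  vclass x = vclass y <-> exists m, y = vtrans m x.
Proof. by split=> [h|h]; [apply/vquot_eqP/eqP|apply/eqP/vquot_eqP]. Qed.

Lemma eclassP (e f : edge G) :
  eclass e = eclass f <-> exists m, f = etrans m e.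
Proof. by split=> [h|h]; [apply/equot_eqP/eqP|apply/eqP/equot_eqP]. Qed.

Lemma erepr_trans (e : edge G) : exists m, erepr (eclass e) = etrans m e.
Proof. by apply/eclassP; rewrite ereprK. Qed.

Lemma vrepr_trans (x : vert G) : exists m, vrepr (vclass x) = vtrans m x.
Proof. by apply/vclassP; rewrite vreprK. Qed.

Lemma fsrc_pi e : fsrc (eclass e) = vclass (src e).
Proof.
rewrite /fsrc; have [m ->] := erepr_trans e.
by apply/esym/vclassP; exists m; rewrite src_etrans.
Qed.

Lemma ftgt_pi e : ftgt (eclass e) = vclass (tgt e).
Proof.
rewrite /ftgt; have [m ->] := erepr_trans e.
by apply/esym/vclassP; exists m; rewrite tgt_etrans.
Qed.

Lemma finv_pi e : finv (eclass e) = eclass (einv e).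
Proof.
rewrite /finv; have [m ->] := erepr_trans e.
by apply/esym/eclassP; exists m; rewrite einv_etrans.
Qed.

Lemma findex_pi e : findex (eclass e) = edge_index e.
Proof.
rewrite /findex; have [m ->] := erepr_trans e.
rewrite /edge_index src_etrans tgt_etrans !pos_vtrans.
by rewrite !(lattice_partD (basis_unit G)) opprD addrACA subrr addr0.
Qed.

Lemma fdegree_pi x : fdegree (vclass x) = degree x.
Proof.
rewrite /fdegree; have [m ->] := vrepr_trans x.
have -> : degree (vtrans m x) = #|` etrans m @` fset_set [set e : edge G | src e = x] |%fset.
  congr (#|` _|); apply/fsetP => e.
  rewrite in_fset_set; last exact: pg_locally_finite.
  apply/idP/imfsetP => /= [|[f]].
    rewrite inE /= => he; exists (etrans (- m) e).
      rewrite in_fset_set; last exact: pg_locally_finite.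
      by rewrite inE /= src_etrans he -vtransD addNr vtrans0.
    by rewrite -etransD subrr etrans0.
  rewrite in_fset_set; last exact: pg_locally_finite.
  by rewrite !inE /= => hf ->; rewrite src_etrans hf.
apply: card_imfset => e f /(congr1 (etrans (- m))).
by rewrite -!etransD addNr !etrans0.
Qed.

Definition no_loops : Prop := forall e : fedge, fsrc e <> ftgt e.

(* Two edges with the same end points are equal as unoriented edges. *)
Definition no_multiple_edges : Prop := forall e f : fedge,
  fsrc e = fsrc f -> ftgt e = ftgt f -> f = e \/ f = finv e.

End FundamentalGraph.

Definition periodic_potential (R : realType) (d : nat) (G : periodicGraph R d)
  (V : vert G -> R) : Prop := forall m x, V (vtrans m x) = V x.

Section Operators.
Variables (R : realType) (d : nat) (G : periodicGraph R d) (V : vert G -> R).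

Definition fpot (x : fvert G) : R := V (vrepr x).

Lemma fpot_pi (V_per : periodic_potential V) x : fpot (vclass x) = V x.
Proof. by rewrite /fpot; have [m ->] := vrepr_trans x. Qed.

Definition pairing (m : 'rV[int]_d) (k : 'rV[R]_d) : R :=
  \sum_s (m 0 s)%:~R * k 0 s.

Definition expi (t : R) : R[i] := cos t +i* sin t.

Definition fiber_adjacency (k : 'rV[R]_d) (f : fvert G -> R[i]) (x : fvert G)
  : R[i] := \sum_(e : fedge G | fsrc e == x)
    expi (pairing (findex e) k) * f (ftgt e).

Definition fiber_schrodinger (k : 'rV[R]_d) (f : fvert G -> R[i]) (x : fvert G)
  : R[i] := fiber_adjacency k f x - (fdegree x)%:R * f x + (fpot x)%:C * f x.

(* The matrix of the fiber operator in the standard basis of functions on fvert G. *)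
Definition fiber_mx (k : 'rV[R]_d) : 'M[R[i]]_#|fvert G| :=
  \matrix_(i, j) fiber_schrodinger k
    (fun y => (y == enum_val j)%:R) (enum_val i).

Definition fv (x : fvert G) : R := fpot x - (fdegree x)%:R.

Definition medge : finType := (fedge G + fvert G)%type.

Definition msrc (e : medge) : fvert G :=
  match e with inl a => fsrc a | inr x => x end.
Definition mtgt (e : medge) : fvert G :=
  match e with inl a => ftgt a | inr x => x end.
Definition mindex (e : medge) : 'rV[int]_d :=
  match e with inl a => findex a | inr _ => 0 end.
Definition mweight (e : medge) : R :=
  match e with inl _ => 1 | inr x => fv x end.

Definition cycles (n : nat) : {set n.-tuple (fedge G)} :=
  [set c : n.-tuple (fedge G) | cycle [rel e f | ftgt e == fsrc f] c]%SET.
Definition mcycles (n : nat) : {set n.-tuple medge} :=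
  [set c : n.-tuple medge | cycle [rel e f | mtgt e == msrc f] c]%SET.

Definition cycle_index (c : seq (fedge G)) : 'rV[int]_d :=
  \sum_(e <- c) findex e.
Definition mcycle_index (c : seq medge) : 'rV[int]_d :=
  \sum_(e <- c) mindex e.
Definition mcycle_weight (c : seq medge) : R := \prod_(e <- c) mweight e.
Definition cycle_v (c : seq (fedge G)) : R := \sum_(e <- c) fv (fsrc e).

Definition trace_formula (n : nat) (k : 'rV[R]_d) : R :=
  \sum_(c in mcycles n) mcycle_weight c * cos (pairing (mcycle_index c) k).

(* All operators and sums depend on k only modulo (2 pi Z)^d. *)
Lemma expi_pairing_periodic (m n : 'rV[int]_d) (k : 'rV[R]_d) :
  expi (pairing m (k + (pi *+ 2) *: map_mx intr n)) = expi (pairing m k).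
Proof.
have -> : pairing m (k + (pi *+ 2) *: map_mx intr n) =
          pairing m k + (pi *+ 2) *~ (\sum_s m 0 s * n 0 s).
  rewrite /pairing -mulrzl raddf_sum /= mulr_suml -big_split /=.
  apply: eq_bigr => s _; rewrite !mxE mulrDr intrM; congr (_ + _).
  by rewrite [X in _ * X]mulrC mulrA.
have cosz (p : int) (t : R) : cos (t + (pi *+ 2) *~ p) = cos t.
  case: p => p; first by rewrite -pmulrn (periodicn (@cosD2pi R)).
  by rewrite NegzE mulrNz -[LHS](periodicn (@cosD2pi R) p.+1) -pmulrn subrK.
have sinz (p : int) (t : R) : sin (t + (pi *+ 2) *~ p) = sin t.
  case: p => p; first by rewrite -pmulrn (periodicn (@sinD2pi R)).
  by rewrite NegzE mulrNz -[LHS](periodicn (@sinD2pi R) p.+1) -pmulrn subrK.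
by rewrite /expi cosz sinz.
Qed.

End Operators.

Definition eigenvalues_of (R : realType) (N : nat) (M : 'M[R[i]]_N)
  (l : N.-tuple R) : Prop :=
  sorted <=%R l /\ char_poly M = \prod_(a <- l) ('X - (a%:C)%:P).

(* Main.v *)
Require Import Defs.
From HB Require Import structures.
From mathcomp Require Import all_boot all_order all_algebra.
From mathcomp Require Import generic_quotient finmap complex.
From mathcomp Require Import all_classical all_reals.
From mathcomp Require Import trigo ring.

Set Implicit Arguments.
Unset Strict Implicit.
Unset Printing Implicit Defensive.

Import Order.TTheory GRing.Theory Num.Theory.

Local Open Scope ring_scope.
Local Open Scope complex_scope.

(* H(k) is the weighted adjacency matrix of the modified fundamental graph, an
   edge e having the weight omega(e) exp(i <tau(e), k>). Hence Tr H(k)^n is the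
   sum over closed walks of length n of the products of these weights, that is,
   of omega(c) exp(i <tau(c), k>). Inversion of edges negates the index, so H(k)
   is Hermitian; its eigenvalues are real, and so is the trace, which leaves
   only the cosines. *)

(** * Sums over tuples, split off entry by entry *)

Lemma big_tuple0 (R : nmodType) (T : finType) (P : pred (0.-tuple T))
    (F : 0.-tuple T -> R) :
  \sum_(c | P c) F c = if P [tuple] then F [tuple] else 0.
Proof.
rewrite (eq_bigl (fun c => (c == [tuple]) && P [tuple])); last first.
  by move=> c; rewrite [c]tuple0 eqxx.
case: ifP => P0; last by rewrite big_pred0// => c; rewrite andbF.
by rewrite (big_pred1 [tuple])// => c; rewrite andbT.
Qed.

Lemma big_tupleS (R : nmodType) (T : finType) n (P : pred (n.+1.-tuple T))
    (F : n.+1.-tuple T -> R) :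
  \sum_(c | P c) F c =
  \sum_(e : T) \sum_(c : n.-tuple T | P [tuple of e :: c]) F [tuple of e :: c].
Proof.
pose f (p : T * n.-tuple T) := [tuple of p.1 :: p.2].
rewrite pair_big_dep /= (reindex f) //=.
exists (fun c : n.+1.-tuple T => (thead c, [tuple of behead c])) => [[e c] _|c _].
  by congr (_, _); apply: val_inj.
by rewrite /f /= -tuple_eta.
Qed.

Lemma big_tuple1 (R : nmodType) (T : finType) (P : pred (1.-tuple T))
    (F : 1.-tuple T -> R) :
  \sum_(c | P c) F c = \sum_(e | P [tuple e]) F [tuple e].
Proof.
by rewrite big_tupleS [RHS]big_mkcond; apply: eq_bigr => e _; rewrite big_tuple0.
Qed.

Lemma big_tuple2 (R : nmodType) (T : finType) (P : pred (2.-tuple T))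
    (F : 2.-tuple T -> R) :
  \sum_(c | P c) F c = \sum_e \sum_(f | P [tuple e; f]) F [tuple e; f].
Proof. by rewrite big_tupleS; apply: eq_bigr => e _; rewrite big_tuple1. Qed.

(** * Powers of a weighted adjacency matrix and closed walks *)

Section ClosedWalks.
Variables (R : comPzRingType) (T E : finType) (s t : E -> T) (w : E -> R).

Definition weighted_adjacency : 'M[R]_#|T| :=
  \matrix_(i, j) \sum_(e | (s e == enum_val i) && (t e == enum_val j)) w e.

Fixpoint walkb (x : T) (p : seq E) (y : T) : bool :=
  if p is e :: p' then (s e == x) && walkb (t e) p' y else x == y.

(** Induction on the length, splitting off the first edge of the walk: its target is the
    intermediate index in the matrix product. *)
Lemma weighted_adjacency_exp n i j :
  (weighted_adjacency ^+ n) i j =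
  \sum_(c : n.-tuple E | walkb (enum_val i) c (enum_val j)) \prod_(e <- c) w e.
Proof.
elim: n i j => [|n IHn] i j.
  rewrite big_tuple0 expr0 mxE /= big_nil (inj_eq enum_val_inj).
  by case: (i == j).
rewrite exprS mxE big_tupleS.
under eq_bigr do rewrite mxE IHn mulr_suml.
rewrite (exchange_big_dep (fun e => s e == enum_val i)) /=; last first.
  by move=> k e _ /andP[].
rewrite [RHS](bigID (fun e => s e == enum_val i)) /= [X in _ + X]big1 ?addr0.
  (* Once [e] is fixed, only the index of [t e] survives in the inner sum. *)
  apply: eq_bigr => e se; rewrite (big_pred1 (enum_rank (t e))).
    rewrite se /= enum_rankK mulr_sumr.
    by apply: eq_bigr => c _; rewrite big_cons.
  move=> k; rewrite se /= -(inj_eq enum_val_inj) enum_rankK eq_sym //.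
by move=> e /negPf ->; rewrite big_pred0.
Qed.

(** Serves to turn closed walks into [cycle]: for [f := e] the right side is what [cycle] means on
    [e :: p]. The two edges are kept apart because [e] advances along [p] in the induction while [f]
    stays. *)
Lemma walkb_path e p f :
  walkb (t e) p (s f) = path [rel e f | t e == s f] e (rcons p f).
Proof.
by elim: p e => [|g p IHp] e /=; rewrite ?andbT // IHp eq_sym.
Qed.

(** A diagonal entry sums over the walks returning to its vertex, and the first edge of a nonempty
    walk fixes that vertex. For [n = 0] the trace would be [#|T|], whereas the empty cycle counts
    once. *)
Lemma trace_weighted_adjacency_exp n : (0 < n)%N ->
  \tr (weighted_adjacency ^+ n) =
  \sum_(c : n.-tuple E | cycle [rel e f | t e == s f] c) \prod_(e <- c) w e.
Proof.
case: n => // n _; rewrite /mxtrace.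
under eq_bigr do rewrite weighted_adjacency_exp big_tupleS /=.
rewrite exchange_big big_tupleS; apply: eq_bigr => e _ /=.
(* A walk beginning with [e] is counted only in the diagonal entry of [s e]. *)
rewrite (bigD1 (enum_rank (s e))) //= [X in _ + X]big1 ?addr0 => [|k].
  by apply: eq_bigl => c; rewrite enum_rankK eqxx /= walkb_path.
rewrite -(inj_eq enum_val_inj) enum_rankK eq_sym => /negPf ->.
by rewrite big_pred0.
Qed.

End ClosedWalks.

(** * Spectrum and power traces of Hermitian matrices *)

Section Spectral.

(** Over polynomials, [P (X - A) = (X - D) P] since the scalar matrix [X] commutes with [P]; take
    determinants and cancel the nonzero [\det P]. *)
Lemma char_poly_similar (F : fieldType) N (P A D : 'M[F]_N) :
  P \in unitmx -> P *m A = D *m P -> char_poly A = char_poly D.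
Proof.
move=> Pu PA; pose PP := map_mx (@polyC F) P.
have PP0 : \det PP != 0.
  by rewrite det_map_mx polyC_eq0 -unitfE; move: Pu; rewrite unitmxE.
apply: (mulfI PP0); rewrite [RHS]mulrC /char_poly -!det_mulmx; congr (\det _).
by rewrite mulmxBl mulmxBr -!map_mxM PA scalar_mxC.
Qed.

Lemma expmx_similar (R : pzRingType) N (P A D : 'M[R]_N) n :
  P *m A = D *m P -> P *m (A ^+ n) = (D ^+ n) *m P.
Proof.
move=> PA; elim: n => [|n IHn]; first by rewrite !expr0 mulmx1 mul1mx.
by rewrite !exprS mulmxA PA -mulmxA IHn mulmxA.
Qed.

Lemma diag_mxX (R : pzRingType) N (u : 'rV[R]_N) n :
  diag_mx u ^+ n = diag_mx (map_mx (fun x => x ^+ n) u).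
Proof.
elim: n => [|n IHn].
  by apply/matrixP => i j; rewrite !mxE.
rewrite exprS IHn [LHS]mulmx_diag; congr diag_mx.
by apply/rowP => j; rewrite !mxE exprS.
Qed.

Variable R : rcfType.

(** By the spectral theorem [A] is similar to a diagonal matrix with real entries. One sorted tuple
    of these entries gives both the characteristic polynomial and every power trace. *)
Lemma hermitian_real_spectrum N (A : 'M[R[i]]_N) :
  (forall i j, A j i = (A i j)^* ) ->
  exists l : N.-tuple R, sorted <=%R l /\
    char_poly A = \prod_(a <- l) ('X - (a%:C)%:P) /\
    forall n, \tr (A ^+ n) = (\sum_(j < N) tnth l j ^+ n)%:C.
Proof.
move=> Aherm.
have hA : A \is hermsymmx.
  apply/is_hermitianmxP; rewrite expr0 scale1r; apply/matrixP => i j.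
  by rewrite !mxE Aherm.
have /hermitian_normalmx /orthomx_spectralP := hA.
have /mxOverP := hermitian_spectral_diag_real hA.
have := spectral_unit A.
move: (spectralmx A) (spectral_diag A) => P sp Pu sp_real AE.
have [r rE] : exists r : N.-tuple R, forall j, (tnth r j)%:C = sp 0 j.
  by exists [tuple complex.Re (sp 0 j) | j < N] => j; rewrite tnth_mktuple RRe_real.
have PA : P *m A = diag_mx sp *m P by rewrite AE !mulmxA mulmxV ?mul1mx.
(* Sorting only permutes the entries, which affects neither the product nor the power sums. *)
have perm_r : perm_eq (sort <=%R r) r by rewrite perm_sort.
exists (sort_tuple <=%R r); split; first exact: sort_sorted (@le_total _ _) _.
split=> [|n].
  rewrite (char_poly_similar Pu PA) (perm_big _ perm_r) /= big_tuple.
  rewrite char_poly_trig ?diag_mx_is_trig//.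
  by apply: eq_bigr => j _; rewrite rE mxE eqxx.
have -> : A ^+ n = invmx P *m (diag_mx sp ^+ n *m P).
  by rewrite -(expmx_similar n PA) mulKmx.
rewrite mxtrace_mulC mulmxK // diag_mxX mxtrace_diag.
rewrite -(big_tuple _ _ (sort_tuple <=%R r) predT (fun x => x ^+ n)).
rewrite (perm_big _ perm_r) big_tuple rmorph_sum /=.
by apply: eq_bigr => j _; rewrite mxE rmorphXn -rE.
Qed.

End Spectral.

(** * The phases exp(i <m, k>) as characters in the index m *)

Section Expi.
Variable R : realType.
Implicit Types s t : R.

Lemma expi0 : expi 0 = 1 :> R[i].
Proof. by rewrite /expi cos0 sin0. Qed.

Lemma expiD s t : expi (s + t) = expi s * expi t.
Proof.
rewrite /expi cosD sinD; apply/eqP; rewrite eq_complex /=.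
by rewrite eqxx /= addrC.
Qed.

Lemma expiN t : expi (- t) = (expi t)^*.
Proof. by rewrite /expi cosN sinN. Qed.

End Expi.

Section Pairing.
Variables (R : realType) (d : nat) (k : 'rV[R]_d).
Implicit Types m n : 'rV[int]_d.

Lemma pairing0 : pairing 0 k = 0.
Proof. by rewrite /pairing big1 // => s _; rewrite mxE mul0r. Qed.

Lemma pairingD m n : pairing (m + n) k = pairing m k + pairing n k.
Proof.
by rewrite /pairing -big_split; apply: eq_bigr => s _; rewrite mxE intrD mulrDl.
Qed.

Lemma pairingN m : pairing (- m) k = - pairing m k.
Proof.
by rewrite /pairing -sumrN; apply: eq_bigr => s _; rewrite mxE intrN mulNr.
Qed.

Lemma expi_pairing_sum (I : Type) (r : seq I) (F : I -> 'rV[int]_d) :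
  expi (pairing (\sum_(e <- r) F e) k) = \prod_(e <- r) expi (pairing (F e) k).
Proof.
elim: r => [|e r IHr]; first by rewrite !big_nil pairing0 expi0.
by rewrite !big_cons pairingD expiD IHr.
Qed.

End Pairing.

(* The library fingraph declares other constants with these names. *)
Local Notation finv := Defs.finv.
Local Notation findex := Defs.findex.

(** * Inversion, degrees and edge count in the fundamental graph *)

Section FundamentalGraphTheory.
Variables (R : realType) (d : nat) (G : periodicGraph R d).
Implicit Types (e f : fedge G) (x y : fvert G).

(** The displacement of a vertex under [m] is the lattice vector of [m], which vanishes only for
    [m = 0] because the basis matrix is invertible. *)
Lemma vtrans_free m (x : vert G) : vtrans m x = x -> m = 0.
Proof.
move=> /(congr1 (@pos _ _ G)); rewrite pos_vtrans => /eqP.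
rewrite -subr_eq0 addrAC subrr add0r => /eqP /(congr1 (mulmx^~ (invmx (basis G)))).
rewrite /lattice_vec mulmxK ?basis_unit // mul0mx => /rowP m0.
by apply/rowP => s; have := m0 s; rewrite !mxE => /eqP; rewrite intr_eq0 => /eqP.
Qed.

Lemma finvK : involutive (@finv R d G).
Proof. by move=> e; rewrite -[e]ereprK !finv_pi einvK. Qed.

Lemma fsrc_finv e : fsrc (finv e) = ftgt e.
Proof. by rewrite -[e]ereprK finv_pi fsrc_pi ftgt_pi src_einv. Qed.

Lemma ftgt_finv e : ftgt (finv e) = fsrc e.
Proof. by rewrite -{2}[e]finvK fsrc_finv. Qed.

Lemma findex_finv e : findex (finv e) = - findex e.
Proof.
rewrite -[e]ereprK finv_pi !findex_pi /edge_index opprB src_einv.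
by rewrite -(src_einv (einv _)) einvK.
Qed.

(* Translations act freely on vertices, so the class map is a bijection from
   the edges starting at a vertex to the classes starting at its class. *)
Lemma fdegreeE x : fdegree x = #|[set e | fsrc e == x]|.
Proof.
rewrite /fdegree /degree.
have srcP (e : edge G) :
    (e \in fset_set [set e : edge G | src e = vrepr x]%classic) = (src e == vrepr x).
  rewrite in_fset_set; last exact: pg_locally_finite.
  by apply/idP/eqP; rewrite inE.
rewrite -(size_map (@eclass _ _ G)) cardE; apply/esym/perm_size/uniq_perm.
- exact: enum_uniq.
- rewrite map_inj_in_uniq ?fset_uniq // => e f; rewrite !srcP => /eqP se /eqP sf.
  move=> /eclassP[m fE]; have m0 : m = 0.
    by apply: (@vtrans_free _ (vrepr x)); rewrite -{1}se -src_etrans -fE.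
  by rewrite fE m0 etrans0.
move=> e; rewrite mem_enum inE; apply/eqP/mapP => [se|[f]]; last first.
  by rewrite srcP => /eqP sf ->; rewrite fsrc_pi sf vreprK.
have /vclassP[m xE] : vclass (src (erepr e)) = vclass (vrepr x) by rewrite vreprK.
exists (Defs.etrans m (erepr e)); first by rewrite srcP src_etrans xE.
by rewrite -{1}[e]ereprK; apply/eclassP; exists m.
Qed.

Lemma card_fedge : #|fedge G| = (\sum_(x : fvert G) fdegree x)%N.
Proof.
rewrite -sum1_card (partition_big (@fsrc _ _ G) predT) //=.
by apply: eq_bigr => x _; rewrite fdegreeE -sum1_card; apply: eq_bigl => e; rewrite inE.
Qed.

(** An infinite graph has two distinct vertices; by connectedness a walk joins them, and it cannot
    be empty, so its first edge yields a class. *)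
Lemma fedge_gt0 : (0 < #|fedge G|)%N.
Proof.
have [x [y xy]] : exists x y : vert G, x <> y.
  (* Otherwise the vertex set is empty or a singleton, hence finite. *)
  apply: contrapT => noxy; apply: (@pg_infinite _ _ G).
  have [[x _]|/forallNP noV] := pselect (exists x : vert G, True).
    apply: (@sub_finite_set _ _ [set x]%classic) => [y _|]; last exact: finite_set1.
    by apply: contrapT => yx; apply: noxy; exists y, x.
  by rewrite (_ : setT = set0) // -subset0 => x _; case: (noV x).
have [[|e p]] := pg_connected x y; first by [].
by move=> _; apply/card_gt0P; exists (eclass e).
Qed.

End FundamentalGraphTheory.

(** * The fiber operator as a weighted adjacency matrix *)

Section FiberOperator.
Variables (R : realType) (d : nat) (G : periodicGraph R d) (V : vert G -> R).
Variable k : 'rV[R]_d.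

Definition fiber_weight (e : medge G) : R[i] :=
  (mweight V e)%:C * expi (pairing (mindex e) k).

Lemma fiber_weight_inl e : fiber_weight (inl e) = expi (pairing (findex e) k).
Proof. by rewrite /fiber_weight rmorph1 mul1r. Qed.

Lemma fiber_weight_inr x : fiber_weight (inr x) = (fv V x)%:C.
Proof. by rewrite /fiber_weight pairing0 expi0 mulr1. Qed.

(** The original edges reproduce the adjacency part. An added loop meets the entry [(i, j)] only
    when [i = j], so the added loops carry the diagonal part, potential minus degree. *)
Lemma fiber_mxE :
  fiber_mx V k = weighted_adjacency (@msrc _ _ G) (@mtgt _ _ G) fiber_weight.
Proof.
apply/matrixP => i j; rewrite !mxE big_sumType /=.
rewrite /fiber_schrodinger /fiber_adjacency -addrA; congr (_ + _).
  rewrite [RHS]big_mkcondr; apply: eq_bigr => e _; rewrite fiber_weight_inl.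
  by case: (ftgt e == _); rewrite ?mulr1 ?mulr0.
rewrite [RHS](eq_bigl (fun x => (x == enum_val i) && (enum_val i == enum_val j))); last first.
  by move=> x /=; case: eqP => //= ->.
case: eqP => [->|_]; last by rewrite !mulr0 oppr0 addr0 big_pred0// => x; rewrite andbF.
rewrite (big_pred1 (enum_val j)) => [|x]; last by rewrite andbT.
by rewrite !mulr1 fiber_weight_inr /fv rmorphB rmorph_nat addrC.
Qed.

(** Reindexing by edge inversion exchanges the two ends and conjugates the phase; the weights of the
    added loops are real. *)
Lemma fiber_mx_hermitian i j : fiber_mx V k j i = (fiber_mx V k i j)^*.
Proof.
rewrite fiber_mxE !mxE !big_sumType /= [RHS]rmorphD !rmorph_sum; congr (_ + _).
  rewrite (reindex_inj (can_inj (@finvK _ _ G))).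
  apply: eq_big => [e|e _]; first by rewrite fsrc_finv ftgt_finv andbC.
  by rewrite !fiber_weight_inl findex_finv pairingN expiN.
apply: eq_big => [x|x _]; first by rewrite andbC.
by rewrite !fiber_weight_inr; apply/esym/conjc_real.
Qed.

Lemma prod_fiber_weight (c : seq (medge G)) :
  \prod_(e <- c) fiber_weight e =
  (mcycle_weight V c)%:C * expi (pairing (mcycle_index c) k).
Proof. by rewrite big_split /= -rmorph_prod expi_pairing_sum. Qed.

(** Cycle weights are real, so taking real parts turns each phase into a cosine. That the trace
    itself is real comes separately, from the real spectrum. *)
Lemma Re_trace_fiber_mx n : (0 < n)%N ->
  complex.Re (\tr (fiber_mx V k ^+ n)) = trace_formula V n k.
Proof.
move=> n0; rewrite fiber_mxE trace_weighted_adjacency_exp // raddf_sum /=.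
rewrite /trace_formula; apply: eq_big => [c|c _]; first by rewrite inE.
by rewrite prod_fiber_weight /= mul0r subr0.
Qed.

(** * Cycles of length 1 and 2 *)

Lemma mem_cycles1 (e : fedge G) : ([tuple e] \in cycles G 1) = (ftgt e == fsrc e).
Proof. by rewrite inE /= andbT. Qed.

Lemma mem_cycles2 (e f : fedge G) :
  ([tuple e; f] \in cycles G 2) = (ftgt e == fsrc f) && (ftgt f == fsrc e).
Proof. by rewrite inE /= andbT. Qed.

Lemma mem_mcycles1 (e : medge G) : ([tuple e] \in mcycles G 1) = (mtgt e == msrc e).
Proof. by rewrite inE /= andbT. Qed.

Lemma mem_mcycles2 (e f : medge G) :
  ([tuple e; f] \in mcycles G 2) = (mtgt e == msrc f) && (mtgt f == msrc e).
Proof. by rewrite inE /= andbT. Qed.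

Lemma trace_formula1 :
  trace_formula V 1 k =
  \sum_x fv V x + \sum_(c in cycles G 1) cos (pairing (cycle_index c) k).
Proof.
rewrite /trace_formula !big_tuple1 big_sumType [RHS]addrC; congr (_ + _).
  apply: eq_big => [e|e _]; first by rewrite mem_mcycles1 mem_cycles1.
  by rewrite /mcycle_weight /mcycle_index /cycle_index !big_seq1 mul1r.
apply: eq_big => [x|x _]; first by rewrite mem_mcycles1 eqxx.
by rewrite /mcycle_weight /mcycle_index !big_seq1 pairing0 cos0 mulr1.
Qed.

Let term (e f : medge G) : R :=
  mcycle_weight V [:: e; f] * cos (pairing (mcycle_index [:: e; f]) k).

Let termE e f :
  term e f = mweight V e * mweight V f * cos (pairing (mindex e + mindex f) k).
Proof.
by rewrite /term /mcycle_weight /mcycle_index !big_cons !big_nil mulr1 addr0.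
Qed.

(** The 2-cycles are sorted by whether each edge is original or added. Two original edges form a
    cycle of the fundamental graph; two added loops must coincide and give a squared weight; a mixed
    pair is an original loop with the added loop at its vertex, and its two orders produce the
    factor 2. *)
Lemma trace_formula2 :
  trace_formula V 2 k =
  \sum_x fv V x ^+ 2 +
  2 * \sum_(c in cycles G 1) cycle_v V c * cos (pairing (cycle_index c) k) +
  \sum_(c in cycles G 2) cos (pairing (cycle_index c) k).
Proof.
have edge_edge (a : fedge G) :
    \sum_(b : fedge G | [tuple inl a; inl b] \in mcycles G 2) term (inl a) (inl b) =
    \sum_(b | [tuple a; b] \in cycles G 2) cos (pairing (cycle_index [tuple a; b]) k).
  apply: eq_big => [b|b _]; first by rewrite mem_mcycles2 mem_cycles2.
  by rewrite termE !mul1r /cycle_index !big_cons big_nil addr0.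
have edge_vert (a : fedge G) :
    \sum_(x : fvert G | [tuple inl a; inr x] \in mcycles G 2) term (inl a) (inr x) =
    if ftgt a == fsrc a then fv V (fsrc a) * cos (pairing (findex a) k) else 0.
  case: eqP => [a_loop|a_noloop].
    rewrite (big_pred1 (fsrc a)) => [|x]; last first.
      by rewrite mem_mcycles2 /= a_loop eq_sym andbb.
    by rewrite termE mul1r addr0.
  rewrite big_pred0 // => x; rewrite mem_mcycles2 /=.
  by apply/andP => -[/eqP ax /eqP xa]; apply: a_noloop; rewrite ax xa.
have vert_edge (x : fvert G) :
    \sum_(a : fedge G | [tuple inr x; inl a] \in mcycles G 2) term (inr x) (inl a) =
    \sum_(a | (fsrc a == x) && (ftgt a == fsrc a))
      fv V (fsrc a) * cos (pairing (findex a) k).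
  apply: eq_big => [a|a]; rewrite mem_mcycles2 /=; last first.
    by case/andP => /eqP -> _; rewrite termE mulr1 add0r.
  by rewrite [x == _]eq_sym; case: eqP => //= ->.
have vert_vert (x : fvert G) :
    \sum_(y : fvert G | [tuple inr x; inr y] \in mcycles G 2) term (inr x) (inr y) =
    fv V x ^+ 2.
  rewrite (big_pred1 x) => [|y]; last by rewrite mem_mcycles2 /= eq_sym andbb.
  by rewrite termE addr0 pairing0 cos0 mulr1.
rewrite /trace_formula !big_tuple2 big_tuple1 big_sumType.
pose loop (a : fedge G) := fv V (fsrc a) * cos (pairing (findex a) k).
transitivity (\sum_(a : fedge G)
    (\sum_(b | [tuple a; b] \in cycles G 2) cos (pairing (cycle_index [tuple a; b]) k)
     + if ftgt a == fsrc a then loop a else 0) +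
  \sum_x (\sum_(a | (fsrc a == x) && (ftgt a == fsrc a)) loop a + fv V x ^+ 2)).
  congr (_ + _); apply: eq_bigr => z _.
    by rewrite big_sumType -edge_edge -edge_vert.
  by rewrite big_sumType -vert_edge -vert_vert.
(* Mixed pairs that start with an added loop are grouped by vertex; regrouping them by the original
   loop matches them with the other order. *)
have loops_by_vertex :
    \sum_x \sum_(a | (fsrc a == x) && (ftgt a == fsrc a)) loop a =
    \sum_(a | ftgt a == fsrc a) loop a.
  rewrite [RHS](partition_big (@fsrc _ _ G) predT) //=.
  by apply: eq_bigr => x _; apply: eq_bigl => a; rewrite andbC.
have cycles1_loops :
    \sum_(a | [tuple a] \in cycles G 1)
      cycle_v V [tuple a] * cos (pairing (cycle_index [tuple a]) k) =
    \sum_(a | ftgt a == fsrc a) loop a.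
  apply: eq_big => [a|a _]; first by rewrite mem_cycles1.
  by rewrite /cycle_v /cycle_index !big_seq1.
rewrite !big_split /= -big_mkcond loops_by_vertex cycles1_loops.
by ring.
Qed.

Lemma no_loops_cycles1 (F : 1.-tuple (fedge G) -> R) : no_loops G ->
  \sum_(c in cycles G 1) F c = 0.
Proof.
move=> noloop; rewrite big_tuple1 big_pred0 // => e.
by rewrite mem_cycles1 eq_sym; apply/eqP/noloop.
Qed.

(* Without loops and multiple edges, the cycles of length 2 are exactly the
   backtrackings [e, finv e], whose index is 0. *)
Lemma simple_cycles2 : no_loops G -> no_multiple_edges G ->
  \sum_(c in cycles G 2) cos (pairing (cycle_index c) k) = #|fedge G|%:R.
Proof.
move=> noloop nomult; rewrite big_tuple2 -sum1_card natr_sum.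
apply: eq_bigr => e _; rewrite (big_pred1 (finv e)) => [|f]; last first.
  rewrite mem_cycles2; apply/andP/eqP => [[/eqP ef /eqP fe]|->]; last first.
    by rewrite fsrc_finv ftgt_finv !eqxx.
  (* The remaining alternative [f = finv (finv e)], that is [f = e], would make [e] a loop. *)
  have [|||fE] // := nomult (finv e) f; rewrite ?fsrc_finv ?ftgt_finv //.
  by case: (noloop e); rewrite ef fE finvK.
by rewrite /cycle_index !big_cons big_nil addr0 findex_finv subrr pairing0 cos0.
Qed.

End FiberOperator.

Theorem theorem2p4 (R : realType) (d : nat) (G : periodicGraph R d)
    (V : vert G -> R) (V_per : periodic_potential V) (k : 'rV[R]_d) :
  (exists lambda : #|fvert G|.-tuple R,
    eigenvalues_of (fiber_mx V k) lambda /\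
    forall n : nat, (0 < n)%N ->
      \tr (fiber_mx V k ^+ n) =
        (\sum_(j < #|fvert G|) tnth lambda j ^+ n)%:C /\
      \sum_(j < #|fvert G|) tnth lambda j ^+ n = trace_formula V n k) /\
  (\tr (fiber_mx V k) = (trace_formula V 1 k)%:C /\
   trace_formula V 1 k =
     \sum_(x : fvert G) fv V x +
     \sum_(c in cycles G 1) cos (pairing (cycle_index c) k)) /\
  (\tr (fiber_mx V k ^+ 2) = (trace_formula V 2 k)%:C /\
   trace_formula V 2 k =
     \sum_(x : fvert G) fv V x ^+ 2 +
     2 * \sum_(c in cycles G 1)
           cycle_v V c * cos (pairing (cycle_index c) k) +
     \sum_(c in cycles G 2) cos (pairing (cycle_index c) k)) /\
  (no_loops G ->
     (\tr (fiber_mx V k) = (trace_formula V 1 k)%:C /\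
      trace_formula V 1 k = \sum_(x : fvert G) fv V x) /\
     (no_multiple_edges G ->
        \tr (fiber_mx V k ^+ 2) = (trace_formula V 2 k)%:C /\
        trace_formula V 2 k =
          #|fedge G|%:R + \sum_(x : fvert G) fv V x ^+ 2)) /\
  (#|fedge G| = (\sum_(x : fvert G) fdegree x)%N /\ (0 < #|fedge G|)%N).
Proof.
have [l [l_sorted [l_char l_tr]]] := hermitian_real_spectrum (fiber_mx_hermitian V k).
(* Both sides are the real part of the same trace. *)
have l_trace n : (0 < n)%N ->
    \sum_(j < #|fvert G|) tnth l j ^+ n = trace_formula V n k.
  by move=> n0; rewrite -Re_trace_fiber_mx // l_tr.
have trE n : (0 < n)%N -> \tr (fiber_mx V k ^+ n) = (trace_formula V n k)%:C.
  by move=> n0; rewrite l_tr l_trace.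
have tr1E : \tr (fiber_mx V k) = (trace_formula V 1 k)%:C by rewrite -trE.
split; first by exists l; split => // n n0; rewrite l_tr l_trace.
split; first by split => //; exact: trace_formula1.
split; first by split; [exact: trE|exact: trace_formula2].
split; last by split; [exact: card_fedge|exact: fedge_gt0].
move=> noloop; split=> [|nomult].
  by split => //; rewrite trace_formula1 no_loops_cycles1 // addr0.
split; first exact: trE.
by rewrite trace_formula2 no_loops_cycles1 // simple_cycles2 // mulr0 addr0 addrC.
Qed.
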